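(* Let $\mathcal{R}$ and $\mathcal{B}$ be independent homogeneous Poisson processes on $\mathbb{R}$ with the same intensity $\lambda_{\mathcal{R}}=\lambda_{\mathcal{B}}=\lambda\in(0,\infty)$, and let $\nu(\{2\})=\mu(\{2\})=1$, so that every red and every blue point has exactly two stubs. Then, almost surely, the graph given by the two-color stable multi-matching of $\mathcal{R}$ and $\mathcal{B}$ has no infinite connected component.
   Context: The points of $\mathcal{R}$ (its support $[\mathcal{R}]$) are called red points and the points of $\mathcal{B}$ (its support $[\mathcal{B}]$) are called blue points. Each red point is equipped with a number of stubs (half-edges) with law $\nu$ and each blue point with a number of stubs with law $\mu$; here these numbers are all equal to 2. A two-color multi-matching scheme is a point process $\mathcal{M}$ on the space of unordered pairs of points of $\mathbb{R}$ such that almost surely every pair in $[\mathcal{M}]$ consists of one red and one blue point, and in the bipartite graph with vertex set $[\mathcal{R}]\cup[\mathcal{B}]$ and edge set $[\mathcal{M}]$ every vertex has degree equal to its number of stubs. Only simple (no multiple edges) and translation-invariant (law of $\mathcal{M}$ invariant under all translations of $\mathbb{R}$) schemes are considered. A two-color multi-matching is stable if almost surely, for any red point $x$ and any blue point $y$, either $x$ and $y$ are linked by an edge, or at least one of $x$ and $y$ has no incident edge longer than $|x-y|$. It is known that here a stable two-color multi-matching exists and is almost surely unique. It is obtained by the following procedure: repeatedly, call two points compatible if they have different colors, each still has at least one stub left, and no edge has been created between them; create simultaneously an edge between every pair of mutually closest compatible points and remove one stub from each of these points; iterate indefinitely. This is ''the two-color stable multi-matching''. *)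

(* Defs.v *)
From HB Require Import structures.
From mathcomp Require Import all_boot all_order all_algebra.
From mathcomp Require Import all_classical all_reals all_analysis.
From Stdlib Require Import Relation_Operators.

Set Implicit Arguments.
Unset Strict Implicit.
Unset Printing Implicit Defensive.

Import Order.TTheory GRing.Theory Num.Theory.
Import numFieldNormedType.Exports.

Local Open Scope classical_set_scope.
Local Open Scope card_scope.
Local Open Scope ring_scope.

(* Simple point processes are random locally finite sets: a simple counting
   measure is identified with its support. *)

Definition borel (T : topologicalType) : set (set T) :=
  <<s [set U : set T | open U] >>.

Definition locally_finite_set (T : topologicalType) (X : set T) : Prop :=
  forall K : set T, compact K -> finite_set (X `&` K).

(* Sigma-algebra on configurations generated by the counts X |-> #(X `&` A),
   A Borel. *)
Definition config_event (T : topologicalType) : set (set (set T)) :=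
  <<s [set C : set (set T) | exists (A : set T) (n : nat),
        borel A /\ C = [set X | X `&` A #= `I_n]] >>.

Definition point_process (d : measure_display) (Omega : measurableType d)
    (T : topologicalType) (X : Omega -> set T) : Prop :=
  (forall w, locally_finite_set (X w)) /\
  (forall C, config_event C -> measurable (X @^-1` C)).

Definition independent_processes (R : realType) (d : measure_display)
    (Omega : measurableType d) (P : probability Omega R)
    (T U : topologicalType) (X : Omega -> set T) (Y : Omega -> set U) : Prop :=
  forall (C : set (set T)) (D : set (set U)),
    config_event C -> config_event D ->
    P (X @^-1` C `&` Y @^-1` D) = (P (X @^-1` C) * P (Y @^-1` D))%E.

(* The second argument of poisson_prob is a dummy; for a Lebesgue-null A the
   rate is 0 and poisson_prob is the Dirac mass at 0. *)
Definition homogeneous_poisson_process (R : realType) (d : measure_display)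
    (Omega : measurableType d) (P : probability Omega R) (lambda : R)
    (X : Omega -> set R) : Prop :=
  [/\ point_process X,
      forall (A : set (measurableTypeR R)) (k : nat),
        measurable A -> (lebesgue_measure A < +oo)%E ->
        P [set w | X w `&` A #= `I_k] =
        poisson_prob (lambda * fine (lebesgue_measure A)) 0 [set k] &
      forall (n : nat) (A : 'I_n -> set (measurableTypeR R)) (k : 'I_n -> nat),
        (forall i, measurable (A i)) ->
        (forall i, (lebesgue_measure (A i) < +oo)%E) ->
        trivIset setT A ->
        P [set w | forall i, X w `&` A i #= `I_(k i)] =
        (\prod_(i < n) P [set w | (X w `&` A i) #= `I_(k i)])%E].

(* The unordered pair {x, y} is encoded as (min x y, max x y): the space of
   unordered pairs of reals is the closed half-plane p.1 <= p.2. *)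
Definition upair (R : realType) (x y : R) : R * R :=
  (Num.min x y, Num.max x y).

Definition edge (R : realType) (M : set (R * R)) (x y : R) : Prop :=
  M (upair x y).

Definition shift_pairs (R : realType) (t : R) (M : set (R * R)) :
    set (R * R) :=
  [set (p.1 + t, p.2 + t) | p in M].

Definition translation_invariant (R : realType) (d : measure_display)
    (Omega : measurableType d) (P : probability Omega R)
    (M : Omega -> set (R * R)) : Prop :=
  forall (t : R) (C : set (set (R * R))), config_event C ->
    P ((fun w => shift_pairs t (M w)) @^-1` C) = P (M @^-1` C).

(* Every red point has kr stubs and every blue point kb stubs, i.e. the stub
   laws are the Dirac masses at kr and kb. *)
Definition two_color_multimatching (R : realType) (kr kb : nat)
    (red blue : set R) (M : set (R * R)) : Prop :=
  [/\ forall p, M p -> exists x y, [/\ red x, blue y & p = upair x y],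
      forall x, red x -> [set y | edge M x y] #= `I_kr &
      forall y, blue y -> [set x | edge M y x] #= `I_kb].

(* M is a set of pairs, hence there are no multiple edges. *)
Definition two_color_multimatching_scheme (R : realType)
    (d : measure_display) (Omega : measurableType d) (P : probability Omega R)
    (kr kb : nat) (red blue : Omega -> set R) (M : Omega -> set (R * R)) :
    Prop :=
  [/\ point_process M,
      translation_invariant P M &
      {ae P, forall w, two_color_multimatching kr kb (red w) (blue w) (M w)}].

Definition stable (R : realType) (red blue : set R) (M : set (R * R)) : Prop :=
  forall x y, red x -> blue y ->
    [\/ edge M x y,
        forall z, edge M x z -> `|x - z| <= `|x - y| |
        forall z, edge M y z -> `|y - z| <= `|x - y|].

Definition stable_multimatching_scheme (R : realType)
    (d : measure_display) (Omega : measurableType d) (P : probability Omega R)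
    (kr kb : nat) (red blue : Omega -> set R) (M : Omega -> set (R * R)) :
    Prop :=
  two_color_multimatching_scheme P kr kb red blue M /\
  {ae P, forall w, stable (red w) (blue w) (M w)}.

Definition component (R : realType) (M : set (R * R)) (x : R) : set R :=
  [set y | clos_refl_trans R (edge M) x y].

Definition no_infinite_component (R : realType) (red blue : set R)
    (M : set (R * R)) : Prop :=
  forall x, (red `|` blue) x -> finite_set (component M x).

(* Main.v *)
(* By stability, an edge [z w] leaving the interior of the interval of an edge
   [x y] satisfies: [z] or [w] is adjacent to [x] or [y]. Let [C] be an infinite
   component, [p] in [C] and [x y] an edge with [x < p < y]. Since [C] is
   infinite, it leaves the interval, so [x] and [y] are in [C]; as [C] is a
   2-regular infinite path, removing [x], [y] and their two other neighbours
   [x'], [y'] leaves two infinite rays, which avoid the finite set of points of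
   [C] in the interval. Hence [p] is [x'] or [y'], and at most two edges cover
   [p].

   On the other hand, almost surely infinitely many edges cross every rational
   [t]. The probability that exactly [n] edges cross [t] does not depend on [t].
   If [n] edges cross both [s] and [t], the numbers of red and blue points in
   [(s, t]] differ by at most [n], which has probability tending to 0 as
   [t - s] grows because the largest atom of a Poisson law tends to 0. So the
   events for different [t] can be made almost disjoint, and are null. *)
Require Import Defs.
From mathcomp Require Import all_boot all_order all_algebra.
From mathcomp Require Import all_classical all_reals all_analysis.
From mathcomp Require Import finmap zify ring lra.
From Stdlib Require Import Relation_Operators.
Import Order.TTheory GRing.Theory Num.Theory.
Import numFieldNormedType.Exports.
Local Open Scope classical_set_scope.
Local Open Scope ring_scope.

Set Implicit Arguments.
Unset Strict Implicit.
Unset Printing Implicit Defensive.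

(** * Infinite components of 2-regular graphs *)

(** Handshake argument: a new vertex [a] adds [count (e a) s] twice, once as its own degree and once
    spread over the degrees of the others. *)
Lemma even_sum_degrees (T : Type) (e : rel T) (s : seq T) :
  symmetric e -> irreflexive e -> ~~ odd (\sum_(x <- s) count (e x) s).
Proof.
move=> es ei; elim: s => [|a s IH]; first by rewrite big_nil.
rewrite big_cons /= ei add0n.
rewrite big_split /=.
have -> : (\sum_(x <- s) e x a = count (e a) s)%N.
  by rewrite -sum1_count [RHS]big_mkcond/=; apply: eq_bigr => x _; rewrite es;
    case: (e _ _).
by rewrite addnA addnn oddD odd_double.
Qed.

(** Turns the degree into [s] of a vertex with two neighbours into two membership bits, on which
    parity can be read. *)
Lemma count_pair (T : eqType) (s : seq T) (q : pred T) (a b : T) :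
  uniq s -> a != b -> (forall c, q c <-> c = a \/ c = b) ->
  (count q s = (a \in s) + (b \in s))%N.
Proof.
move=> us ab qP; rewrite -!count_uniq_mem// -count_predUI.
rewrite [X in (_ + X)%N](_ : _ = 0)%N ?addn0; last first.
  rewrite -(count_pred0 s); apply: eq_count => c /=.
  by apply: contraNF ab => /andP[/eqP<- /eqP<-].
apply: eq_count => c /=; apply/idP/orP => [/qP|].
  by case=> ->; rewrite eqxx; [left|right].
by case=> /eqP ->; apply/qP; [left|right].
Qed.

Definition closed_under (T : Type) (e : T -> T -> Prop) (Z : set T) :=
  forall v w, Z v -> e v w -> Z w.

Definition two_neighbours (T : Type) (e : T -> T -> Prop) (v : T) :=
  exists a b, a <> b /\ forall c, e v c <-> c = a \/ c = b.

Lemma other_neighbour {T : choiceType} {e : T -> T -> Prop} {v a : T} :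
  two_neighbours e v -> e v a ->
  exists b, a <> b /\ forall c, e v c <-> c = a \/ c = b.
Proof.
move=> [b [c [bc vP]]] /vP[] ->; first by exists c.
by exists b; split=> [/esym//|z]; rewrite vP; tauto.
Qed.

Section InfiniteComponent.
Variables (T : choiceType) (e : T -> T -> Prop) (C : set T).
Hypothesis e_sym : forall v w, e v w -> e w v.
Hypothesis e_irr : forall v, ~ e v v.
Hypothesis C_two : forall v, C v -> two_neighbours e v.
Hypothesis C_closed : closed_under e C.
(** Infinity of the component in a form without paths: a contradiction is reached by exhibiting a
    finite closed set through a point of [C]. *)
Hypothesis C_inf : forall Z v,
  finite_set Z -> closed_under e Z -> Z v -> ~ C v.

(** If [x] is outside [C], so is [y], and no edge of [C] can leave [I], since such an edge has an
    end adjacent to [x] or [y]. Then [C] meets [I] in a finite closed set. *)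
Lemma endpoint_in_component (x y : T) (I : set T) (p : T) :
  e x y -> finite_set I ->
  (forall v w, I v -> ~ I w -> e v w -> [\/ e v x, e v y, e w x | e w y]) ->
  C p -> I p -> C x.
Proof.
move=> exy fI exI Cp Ip; apply: contrapT => nCx.
have nCy : ~ C y by move=> Cy; apply: nCx; apply: C_closed Cy _; exact: e_sym.
apply: (@C_inf (C `&` I) p) => //; first exact: finite_setIr.
move=> v w [Cv Iv] vw; have Cw := C_closed Cv vw; split=> //.
apply: contrapT => nIw.
have /= := exI _ _ Iv nIw vw.
by case=> /C_closed H; do ?[by apply: nCx; exact: H | by apply: nCy; exact: H].
Qed.

(* With [A] the set of points of [C] in [I] other than [x'] and [y'], the sum of
   the degrees in [A] shows that the number of edges between [A] and
   [{x', y'}] is even. If it is 0, [A] is closed; if it is 2, adding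
   [x], [y], [x'], [y'] to [A] gives a closed set; both are finite. *)
Lemma neighbour_of_endpoint (x y : T) (I : set T) (p : T) :
  e x y -> finite_set I -> ~ I x -> ~ I y ->
  (forall v w, I v -> ~ I w -> e v w -> [\/ e v x, e v y, e w x | e w y]) ->
  C p -> I p -> e x p \/ e y p.
Proof.
move=> exy fI nIx nIy exI Cp Ip.
have Cx : C x by exact: (@endpoint_in_component x y I p).
have Cy : C y by exact: C_closed exy.
have [x' [yx' xP]] := other_neighbour (C_two Cx) exy.
have [y' [xy' yP]] := other_neighbour (C_two Cy) (e_sym exy).
have exx' : e x x' by apply/xP; right.
have eyy' : e y y' by apply/yP; right.
have xx' : x <> x' by move=> E; apply: (@e_irr x); rewrite {2}E.
have yy' : y <> y' by move=> E; apply: (@e_irr y); rewrite {2}E.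
have Cx' := C_closed Cx exx'.
have Cy' := C_closed Cy eyy'.
have [x2 [xx2 x'P]] := other_neighbour (C_two Cx') (e_sym exx').
have [y2 [yy2 y'P]] := other_neighbour (C_two Cy') (e_sym eyy').
(* If [x' = y'], the points [x], [y], [x'] form a closed triangle. *)
have [E|x'y'] := eqVneq x' y'.
  exfalso; apply: (@C_inf [set` [:: x; y; x']] x) => //=; last by rewrite inE eqxx.
  have x2y : x2 = y.
    have : e x' y by apply: e_sym; rewrite E.
    by case/x'P => // yx; case: (@e_irr x); rewrite -{2}yx.
  move=> v w /=; rewrite !inE => /or3P[] /eqP -> => [/xP|/yP|/x'P] [] ->;
    by rewrite ?x2y ?E eqxx ?orbT.
apply: contrapT => /not_orP[nxp nyp].
set A := [set v | [/\ C v, I v, v <> x' & v <> y']].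
have fA : finite_set A by apply: sub_finite_set fI => v [].
have Ap : A p by split=> // E; [apply: nxp|apply: nyp]; rewrite E.
(* A point of [A] is adjacent to neither [x] nor [y], so an edge from it leaving [I] ends at a
   neighbour of [x] or [y], that is, at [x'] or [y']. *)
have Anb v w : A v -> e v w -> [\/ A w, w = x' | w = y'].
  move=> [Cv Iv vx' vy'] vw.
  have [->|wx'] := eqVneq w x'; first exact: Or32.
  have [->|wy'] := eqVneq w y'; first exact: Or33.
  apply: Or31; split; try (by apply/eqP); first exact: C_closed vw.
  have nvx : ~ e v x.
    by move=> /e_sym/xP[]// vy; apply: nIy; rewrite -vy.
  have nvy : ~ e v y.
    by move=> /e_sym/yP[]// vy; apply: nIx; rewrite -vy.
  apply: contrapT => nIw.
  have := exI _ _ Iv nIw vw; case=> //.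
    move=> /e_sym/xP[] wE; first by apply: nvy; rewrite -wE.
    by move: wx'; rewrite wE eqxx.
  move=> /e_sym/yP[] wE; first by apply: nvx; rewrite -wE.
  by move: wy'; rewrite wE eqxx.
have /finite_seqP[s0 As0] := fA; pose s := undup s0.
have sP v : (v \in s) <-> A v by rewrite mem_undup As0.
have us : uniq s by exact: undup_uniq.
pose eb v w := `[< e v w >].
have ebs : symmetric eb by move=> v w; apply: asbool_equiv_eq; split; apply: e_sym.
have ebi : irreflexive eb by move=> v; apply/asboolP; exact: e_irr.
have x's : x' \notin s by apply/negP => /sP[].
have y's : y' \notin s by apply/negP => /sP[].
have xs : x \notin s by apply/negP => /sP[_ /nIx].
have ys : y \notin s by apply/negP => /sP[_ /nIy].
have cx' : count (eb x') s = (x2 \in s).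
  rewrite (@count_pair _ _ _ x x2)//; last 2 first.
    by apply/eqP. 
  by move=> c; rewrite -x'P; split => /asboolP.
  by rewrite (negPf xs).
have cy' : count (eb y') s = (y2 \in s).
  rewrite (@count_pair _ _ _ y y2)//; last 2 first.
    by apply/eqP. 
  by move=> c; rewrite -y'P; split => /asboolP.
  by rewrite (negPf ys).
(* Both neighbours of each [v] in [s] lie in [[:: x', y' & s]]. Summing over [s] gives an even
   total, and the degrees inside [s] also have an even sum, so the two bits [cx'] and [cy']
   agree. *)
have parity : (x2 \in s) = (y2 \in s).
  have two v : v \in s -> (eb v x' + eb v y' + count (eb v) s = 2)%N.
    move=> /sP Av; have [a [b [/eqP ab vP]]] := C_two (let: And4 c _ _ _ := Av in c).
    have -> : (eb v x' + eb v y' + count (eb v) s = count (eb v) [:: x', y' & s])%N.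
      by rewrite /= addnA.
    rewrite (@count_pair _ _ _ a b)//; first last.
    - by move=> c; rewrite -vP; split => /asboolP.
    - by rewrite /= inE (negPf x'y') x's y's.
    have mem c : e v c -> c \in [:: x', y' & s].
      by move=> /(Anb _ _ Av)[/sP|->|->]; rewrite !inE ?eqxx ?orbT// => ->; rewrite !orbT.
    by rewrite !mem//; apply/vP; tauto.
  have := even_sum_degrees s ebs ebi.
  have : (\sum_(v <- s) (eb v x' + eb v y' + count (eb v) s) = \sum_(v <- s) 2)%N.
    by rewrite !big_seq; apply: eq_bigr => v /two.
  rewrite !big_split/= big_const_seq count_predT iter_addn_0.
  have cnt z : (\sum_(v <- s) eb v z = count (eb z) s)%N.
    by rewrite -sum1_count [RHS]big_mkcond/=; apply: eq_bigr => v _; rewrite ebs;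
      case: (eb _ _).
  rewrite !cnt cx' cy'.
  by case: (x2 \in s); case: (y2 \in s); lia.
have [x2s|x2s] := boolP (x2 \in s); last first.
  apply: (@C_inf A p) => // v w Av vw.
  have [//|wE|wE] := Anb _ _ Av vw.
    have /x'P[vx|vx] : e x' v by apply: e_sym; rewrite -wE.
      by have /sP := Av; rewrite vx (negPf xs).
    by have /sP := Av; rewrite vx (negPf x2s).
  have /y'P[vx|vx] : e y' v by apply: e_sym; rewrite -wE.
    by have /sP := Av; rewrite vx (negPf ys).
  by have /sP := Av; rewrite vx -parity (negPf x2s).
apply: (@C_inf [set` [:: x, y, x', y' & s]] p) => //=; last first.
  by rewrite !inE; move/sP: Ap => ->; rewrite !orbT.
move=> v w /=; rewrite !inE => /or4P[/eqP->|/eqP->|/eqP->|/orP[/eqP->|vs]].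
- by move=> /xP[] ->; rewrite eqxx ?orbT.
- by move=> /yP[] ->; rewrite eqxx ?orbT.
- by move=> /x'P[] ->; rewrite ?x2s ?eqxx ?orbT.
- by move=> /y'P[] ->; rewrite -?parity ?x2s ?eqxx ?orbT.
by move/sP: vs => /Anb H /H[/sP -> |->|->]; rewrite ?eqxx ?orbT.
Qed.

End InfiniteComponent.

(** * Stable multi-matchings on the line *)

Lemma card_seq (T : choiceType) (A : set T) (n : nat) :
  (A #= `I_n)%card -> exists s : seq T, [/\ uniq s, size s = n & A = [set` s]].
Proof.
move=> An; have fA : finite_set A by apply/finite_setP; exists n.
exists (enum_fset (fset_set A)); split; first exact: fset_uniq.
  exact: card_fset_set.
by rewrite -[LHS]fset_setK.
Qed.

Lemma card_two (T : choiceType) (A : set T) :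
  (A #= `I_2)%card -> exists a b, a <> b /\ forall c, A c <-> c = a \/ c = b.
Proof.
move=> /card_seq[s [us s2 ->]]; case: s us s2 => [//|a [//|b [|//]]] /= us _.
exists a, b; split; first by move: us; rewrite inE andbT => /eqP.
move=> c; rewrite /= !inE; split=> [/orP[]/eqP->|[]->]; rewrite ?eqxx ?orbT //.
  by left.
by right.
Qed.

Lemma upairC (R : realType) (x y : R) : upair x y = upair y x.
Proof. by rewrite /upair minC maxC. Qed.

Lemma upair_le (R : realType) (x y : R) : x <= y -> upair x y = (x, y).
Proof. by move=> xy; rewrite /upair min_l // max_r. Qed.

Lemma upair_inj (R : realType) (x y a b : R) : upair x y = upair a b ->
  x = a /\ y = b \/ x = b /\ y = a.
Proof.
wlog xy : x y / x <= y.
  move=> H; have [/H//|/ltW yx] := leP x y.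
  by rewrite upairC => /(H _ _ yx); tauto.
rewrite upair_le//; have [ab|/ltW ab] := leP a b.
  by rewrite upair_le // => -[-> ->]; left.
by rewrite upairC upair_le // => -[-> ->]; right.
Qed.

Section Matching.
Variables (R : realType) (red blue : set R) (M : set (R * R)).
Hypothesis disjoint_colors : forall x, red x -> ~ blue x.
Hypothesis M_matching : two_color_multimatching 2 2 red blue M.

Lemma edge_sym (x y : R) : edge M x y -> edge M y x.
Proof. by rewrite /edge upairC. Qed.

Lemma edge_colors (x y : R) : edge M x y -> red x /\ blue y \/ blue x /\ red y.
Proof.
case: M_matching => Mp _ _ /Mp[a [b [ra bb]]] /upair_inj[] [-> ->]; tauto.
Qed.

Lemma edge_irr (x : R) : ~ edge M x x.
Proof. by move=> /edge_colors[] [] => [/disjoint_colors|/[swap]/disjoint_colors]. Qed.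

Lemma edge_two (x : R) : (red `|` blue) x -> two_neighbours (edge M) x.
Proof.
by case: M_matching => _ Mr Mb [/Mr|/Mb] /card_two.
Qed.

Hypothesis M_stable : stable red blue M.

(** Stability made symmetric in the colours, so that it applies without knowing which of the two
    points is red. *)
Lemma blocking_pair (a b c d : R) :
  red a /\ blue b \/ blue a /\ red b -> edge M a c -> edge M b d ->
  `|a - b| < `|a - c| -> `|a - b| < `|b - d| -> edge M a b.
Proof.
wlog rabb : a b c d / red a /\ blue b.
  move=> H [cab|cab]; first by apply: H => //; left.
  move=> ac bd abac abbd; apply: edge_sym.
  by rewrite (distrC a) in abac abbd; apply: (H _ _ d c) => //; tauto.
move=> _ ac bd abac abbd; have [ra bb] := rabb.
case: (M_stable ra bb) => // [/(_ _ ac)|/(_ _ bd)]; first by rewrite leNgt abac.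
by rewrite leNgt abbd.
Qed.

(** Suppose [z] and [y] have opposite colours, hence also [w] and [x]. If [z] is closer to [y] than
    to [w], then [z] and [y] would block unless linked. Otherwise [w] cannot lie beyond [y], so
    [w < x] and [w] is closer to [x] than to [z], while [|w - x| < |x - y|]; thus [w] and [x] are
    linked. The other colour pattern is the mirror image. *)
Lemma stable_exit (x y z w : R) : edge M x y -> edge M z w ->
  x < z -> z < y -> ~ (x < w < y) ->
  [\/ edge M z x, edge M z y, edge M w x | edge M w y].
Proof.
move=> exy ezw xz zy nw.
have [wx|wx] := eqVneq w x; first by apply: Or41; rewrite -wx.
have [wy|wy] := eqVneq w y; first by apply: Or42; rewrite -wy.
have wout : w < x \/ y < w.
  move: nw => /negP; rewrite negb_and -!leNgt !le_eqVlt (negPf wx) eq_sym (negPf wy) /=.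
  by move=> /orP[]; tauto.
have dist_lt (a b : R) : a < b -> `|a - b| = b - a /\ `|b - a| = b - a.
  by move=> ab; rewrite (distrC a) gtr0_norm ?subr_gt0.
have xy : x < y by exact: lt_trans zy.
have [dxz dzx] := dist_lt _ _ xz; have [dzy dyz] := dist_lt _ _ zy.
have [dxy dyx] := dist_lt _ _ xy.
have eyx := edge_sym exy; have ewz := edge_sym ezw.
have [[czy cwx]|[czx cwy]] : (red z /\ blue y \/ blue z /\ red y) /\
      (red w /\ blue x \/ blue w /\ red x) \/
    (red z /\ blue x \/ blue z /\ red x) /\
      (red w /\ blue y \/ blue w /\ red y).
- by move: (edge_colors exy) (edge_colors ezw); tauto.
- have [zwzy|zwzy] := ltP `|z - y| `|z - w|.
    by apply: Or42; apply: (blocking_pair czy ezw eyx) => //; lra.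
  case: wout => wout; have [dwo dow] := dist_lt _ _ wout; last first.
    by have [dzw _] := dist_lt _ _ (lt_trans zy wout); lra.
  have [dwz dzw] := dist_lt _ _ (lt_trans wout xz).
  by apply: Or43; apply: (blocking_pair cwx ewz exy) => //; lra.
- have [zwzx|zwzx] := ltP `|z - x| `|z - w|.
    by apply: Or41; apply: (blocking_pair czx ezw exy) => //; lra.
  case: wout => wout; have [dwo dow] := dist_lt _ _ wout.
    by have [_ dzw] := dist_lt _ _ (lt_trans wout xz); lra.
  have [dzw dwz] := dist_lt _ _ (lt_trans zy wout).
  by apply: Or44; apply: (blocking_pair cwy ewz eyx) => //; lra.
Qed.

End Matching.

(* Half-open, so that an edge leaving [(s, t]] is in exactly one of [cut s] and
   [cut t]; in the encoding of unordered pairs, [p.1 <= p.2]. *)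
Definition cut (R : realType) (t : R) : set (R * R) :=
  [set p | p.1 <= t < p.2].

(** * Edges crossing a rational next to a point of an infinite component *)

Lemma finite_below (R : realType) (s : seq R) (p : R) :
  exists2 m, m < p & forall v, v \in s -> v < p -> v <= m.
Proof.
elim: s => [|a s [m mp ms]]; first by exists (p - 1); [lra|].
have [ap|pa] := ltP a p.
  exists (Num.max m a); first by rewrite gt_max mp.
  move=> v; rewrite inE le_max => /predU1P[->|/ms H /H ->//].
  by rewrite lexx orbT.
exists m => // v; rewrite inE => /predU1P[->|/ms//].
by rewrite ltNge pa.
Qed.

Lemma finite_itv_points (R : realType) (V : set R) (a b : R) :
  locally_finite_set V -> finite_set (V `&` [set x | a <= x <= b]).
Proof.
by move=> /(_ `[a, b]%classic (@segment_compact _ _ _)).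
Qed.

Lemma closed_clos (T : Type) (e : T -> T -> Prop) (Z : set T) (v w : T) :
  closed_under e Z -> clos_refl_trans T e v w -> Z v -> Z w.
Proof.
move=> Zcl; elim=> {v w} [v w vw /Zcl|//|u v w _ uv _ vw /uv/vw//].
exact.
Qed.

Lemma clos_sym (T : Type) (e : T -> T -> Prop) (v w : T) :
  (forall a b, e a b -> e b a) ->
  clos_refl_trans T e v w -> clos_refl_trans T e w v.
Proof.
move=> es; elim=> {v w} [v w /es vw|v|u v w _ vu _ wv].
- exact: rt_step.
- exact: rt_refl.
exact: rt_trans wv vu.
Qed.

(** For a rational [q] just to the left of [p], an edge crossing [q] either ends at [p] or covers
    [p]. In the second case one of its ends is a neighbour of [p], so at most four edges cross
    [q]. *)
Lemma no_infinite_component_of_cuts (R : realType) (red blue : set R)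
    (M : set (R * R)) :
  (forall x, red x -> ~ blue x) ->
  locally_finite_set red -> locally_finite_set blue ->
  two_color_multimatching 2 2 red blue M ->
  stable red blue M ->
  (forall q : rat, infinite_set (M `&` cut (ratr q))) ->
  no_infinite_component red blue M.
Proof.
move=> dis lfr lfb Mm Ms Minf p Vp; apply: contrapT => Cinf.
set V := red `|` blue in Vp; set C := component M p in Cinf.
have fV a b : finite_set (V `&` [set x | a <= x <= b]).
  by rewrite setIUl finite_setU; split; exact: finite_itv_points.
have eV v w : edge M v w -> V w by move=> /(edge_colors Mm)[] []; [right|left].
have es v w : edge M v w -> edge M w v by exact: edge_sym.
have Ccl : closed_under (edge M) C.
  by move=> v w Cv vw; apply: rt_trans Cv _; exact: rt_step.
have CV v : C v -> V v.
  move=> Cv; apply: (@closed_clos _ (edge M) V p v _ Cv Vp) => a b _ ab.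
  exact: eV ab.
have C2 v : C v -> two_neighbours (edge M) v by move=> /CV; exact: edge_two Mm _.
have Cmin Z v : finite_set Z -> closed_under (edge M) Z -> Z v -> ~ C v.
  move=> fZ Zcl Zv Cv; apply: Cinf; apply: sub_finite_set fZ => u Cu.
  by apply: (closed_clos Zcl _ Zv); apply: rt_trans Cu; exact: clos_sym.
have Cp : C p by exact: rt_refl.
have [a [b [ab pP]]] := C2 _ Cp.
have epa : edge M p a by apply/pP; left.
have epb : edge M p b by apply/pP; right.
have [a2 [_ aP]] := other_neighbour (C2 _ (Ccl _ _ Cp epa)) (es _ _ epa).
have [b2 [_ bP]] := other_neighbour (C2 _ (Ccl _ _ Cp epb)) (es _ _ epb).
(* The window of length 1 makes the points finite in number; [q] is then chosen in it with no point
   of [V] from [q] up to [p], [p] excluded. *)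
have /finite_seqP[s sE] := fV (p - 1) p.
have [m mp ms] := finite_below s p.
have [q qm] : exists q : rat, ratr q \in `](Num.max m (p - 1)), p[.
  by apply: rat_in_itvoo; rewrite gt_max mp; lra.
have := qm; rewrite in_itv/= gt_max => /andP[/andP[mq p1q] qp].
apply: (Minf q).
(* The two edges at [p], and the other edge at each of its neighbours [a] and [b]. *)
apply: (@sub_finite_set _ _
  [set` [:: upair p a; upair p b; upair a a2; upair b b2]]) => // z [Mz].
have [x [y [xy zE]]] : exists x y, x <= y /\ z = upair x y.
  have [Mp _ _] := Mm; have [x [y [_ _ zE]]] := Mp _ Mz.
  have [xy|/ltW yx] := leP x y; [by exists x, y|exists y, x].
  by rewrite upairC.
move=> cz; have /andP[xq qy] : x <= ratr q < y.
  by move: cz; rewrite zE (upair_le xy).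
have exy : edge M x y by rewrite /edge -zE.
have xp : x < p by exact: le_lt_trans qp.
have py : p <= y.
  rewrite leNgt; apply/negP => yp.
  suff /ms/(_ yp) : y \in s by lra.
  have : [set` s] y by rewrite -sE; split; [exact: eV exy|rewrite /=; lra].
  by [].
rewrite /= !inE zE; move: py; rewrite le_eqVlt => /orP[/eqP py|py].
  have /pP[->|->] : edge M p x by apply: es; rewrite py.
    by rewrite -py upairC eqxx.
  by rewrite -py upairC eqxx orbT.
have [/es/pP xab|/es/pP yab] : edge M x p \/ edge M y p.
  apply: (@neighbour_of_endpoint _ (edge M) C es _ C2 Ccl Cmin x y
    (V `&` [set v | x < v < y])) => //.
  - exact: edge_irr dis Mm.
  - apply: sub_finite_set (fV x y) => v [Vv /= /andP[xv vy]].
    by split=> //=; rewrite !ltW.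
  - by move=> [_ /=]; rewrite ltxx.
  - by move=> [_ /=]; rewrite ltxx andbF.
  - move=> v w [Vv /= /andP[xv vy]] nI vw.
    apply: (stable_exit Mm Ms exy vw xv vy) => xwy.
    by apply: nI; split => //; exact: eV vw.
  - by split=> //=; rewrite xp py.
- case: xab => xE; move: exy; rewrite xE.
    by move=> /aP[yE|->]; [move: py; rewrite yE ltxx|rewrite eqxx !orbT].
  by move=> /bP[yE|->]; [move: py; rewrite yE ltxx|rewrite eqxx !orbT].
- case: yab => yE; move: (es _ _ exy); rewrite yE upairC.
    by move=> /aP[xE|->]; [move: xp; rewrite xE ltxx|rewrite eqxx !orbT].
  by move=> /bP[xE|->]; [move: xp; rewrite xE ltxx|rewrite eqxx !orbT].
Qed.

(** * Colour balance between two cuts *)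

Lemma two_color_multimatchingC (R : realType) (kr kb : nat) (red blue : set R)
    (M : set (R * R)) :
  two_color_multimatching kr kb red blue M ->
  two_color_multimatching kb kr blue red M.
Proof.
move=> [Mp Mr Mb]; split => // p /Mp[x [y [rx yb ->]]].
by exists y, x; rewrite upairC.
Qed.

(** Stub counting: each of the [2 * a] edges from red points of the interval ends at one of its blue
    points, which carry [2 * b] stubs, or crosses [s] or [t]. Hence [2 * a <= 2 * b + 2 * n]. *)
Lemma card_red_le (R : realType) (red blue : set R) (M : set (R * R))
    (s t : R) (n a b : nat) :
  (forall x, red x -> ~ blue x) ->
  two_color_multimatching 2 2 red blue M ->
  (M `&` cut s #= `I_n)%card -> (M `&` cut t #= `I_n)%card ->
  (red `&` [set x | s < x <= t] #= `I_a)%card ->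
  (blue `&` [set x | s < x <= t] #= `I_b)%card ->
  (a <= b + n)%N.
Proof.
move=> dis Mm /card_seq[es [_ esn esE]] /card_seq[et [_ etn etE]].
move=> /card_seq[sr [ur <- rE]] /card_seq[sb [_ <- bE]].
(* [nb v] enumerates the two neighbours of [v] by booleans, so that edges can be listed as
   products. *)
have /choice[nb nbP] : forall v, exists f : bool -> R, (red `|` blue) v ->
    f true <> f false /\ forall c, edge M v c <-> c = f true \/ c = f false.
  move=> v; have [/(edge_two Mm)[c [e ce]]|nv] := pselect ((red `|` blue) v).
    by exists (fun i => if i then c else e).
  by exists (fun=> v).
have redP x : x \in sr -> red x /\ s < x <= t.
  by move=> xr; have : [set` sr] x by []; rewrite -rE => -[].
have blueP y : blue y -> s < y <= t -> y \in sb.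
  by move=> yb yI; have : [set` sb] y by rewrite -bE.
have nbe v i : (red `|` blue) v -> edge M v (nb v i).
  by move=> /nbP[_ vP]; apply/vP; case: i; [left|right].
have nbb x i : red x -> blue (nb x i).
  move=> rx; have /(edge_colors Mm)[[]//|[/dis]] := nbe x i (or_introl rx).
  by move=> /(_ rx).
pose L := [seq upair x (nb x i) | x <- sr, i <- [:: true; false]].
pose K := [seq upair y (nb y i) | y <- sb, i <- [:: true; false]] ++ es ++ et.
suff : (size L <= size K)%N.
  by rewrite !size_cat !size_allpairs/= esn etn; lia.
apply: uniq_leq_size.
  (* The red end is determined by the unordered pair, since its other end is blue; only [L] has to
     be free of repetitions. *)
  apply: allpairs_uniq => // -[x i] [x' i'].
  move=> /allpairsP[[z j] [/redP[rz _] _ [-> ->]]].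
  move=> /allpairsP[[z' j'] [/redP[rz' _] _ [-> ->]]].
  rewrite /= in rz rz' *.
  move=> /upair_inj[[zz' ]|[zz' _]]; last first.
    by case: (dis _ rz); rewrite zz'; exact: nbb.
  rewrite zz'; case: j j' => -[] // E; have [] := nbP z' (or_introl rz').
    by rewrite E.
  by rewrite -E.
move=> p /allpairsP[[x i] /= [/redP[rx /andP[sx xt]] _ ->]].
have xy := nbe x i (or_introl rx); have by_ := nbb x i rx.
set y := nb x i in xy by_ *; rewrite !mem_cat.
have [ys|sy] := leP y s.
  apply/orP; right; apply/orP; left.
  have : [set` es] (upair x y); last by [].
  rewrite -esE; split=> //; rewrite upairC upair_le /cut/= ?ys//.
  exact/ltW/(le_lt_trans ys).
have [yt|ty] := leP y t; last first.
  apply/orP; right; apply/orP; right.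
  have : [set` et] (upair x y); last by [].
  rewrite -etE; split=> //; rewrite upair_le /cut/= ?xt//.
  exact/ltW/(le_lt_trans xt).
apply/orP; left; rewrite upairC.
have [j ->] : exists j, x = nb y j.
  have [_ yP] := nbP y (or_intror by_).
  by have /yP[->|->] := edge_sym xy; [exists true|exists false].
apply: allpairs_f; last by case: j.
by apply: blueP => //; rewrite sy.
Qed.

(** * Poisson atoms *)

Lemma poisson_pmfS (R : realType) (s : R) (k : nat) : 0 < s ->
  poisson_pmf s k.+1 * k.+1%:R = poisson_pmf s k * s.
Proof.
move=> s0; rewrite /poisson_pmf s0 factS natrM exprS invfM.
have k0 : k.+1%:R != 0 :> R by rewrite pnatr_eq0.
move: (k.+1%:R) (s ^+ k) (k`!%:R^-1) k0 => c x f c0.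
by rewrite -[RHS]mulr1 -(mulVf c0); ring.
Qed.

(** Up to the factor [expR (- s)], this is part of a partial sum of the exponential series. *)
Lemma sum_poisson_pmf_le1 (R : realType) (s : R) (m r : nat) : 0 < s ->
  \sum_(i < r) poisson_pmf s (m + i) <= 1.
Proof.
move=> s0; apply: (@le_trans _ _ (\sum_(0 <= j < m + r) poisson_pmf s j)).
  rewrite big_mkord big_split_ord/= lerDr sumr_ge0 // => j _.
  exact: poisson_pmf_ge0.
have -> : \sum_(0 <= j < m + r) poisson_pmf s j
    = series (exp_coeff s) (m + r) * expR (- s).
  rewrite /series/= mulr_suml; apply: eq_bigr => j _.
  by rewrite /poisson_pmf s0 exp_coeffE/= (mulrC (_^-1)).
rewrite expRN ler_pdivrMr ?expR_gt0// mul1r.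
apply: nondecreasing_cvgn_le; last exact: is_cvg_series_exp_coeff.
apply/nondecreasing_seqP => n; rewrite /series/= big_nat_recr//= lerDl.
by apply: exp_coeff_ge0; exact: ltW.
Qed.

(* The [r] values of the mass function starting at [k] and going towards the
   mode [s] are at least half the value at [k], and they sum to at most 1. *)
Lemma poisson_pmf_le (R : realType) (s : R) (r k : nat) : (0 < r)%N ->
  2 * r%:R ^+ 2 <= s -> poisson_pmf s k <= 2 / r%:R.
Proof.
move=> r0 rs.
have r1 : 1 <= r%:R :> R by rewrite ler1n.
have s0 : 0 < s by nra.
pose p := poisson_pmf s k; have p0 : 0 <= p by exact: poisson_pmf_ge0.
(* Each step towards the mode multiplies the mass by at least [1 - r / s]. By Bernoulli's
   inequality, [i] steps keep the fraction [1 - i * r / s], which is at least one half because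
   [2 * r ^ 2 <= s]; [step] is the induction step. *)
have bern (i : nat) : (i <= r)%N -> p / 2 <= p * (1 - i%:R * (r%:R / s)).
  move=> ir; rewrite ler_wpM2l //.
  have : i%:R * (r%:R / s) <= 2^-1; last lra.
  have i1 : i%:R <= r%:R :> R by rewrite ler_nat.
  have i0 : 0 <= i%:R :> R by [].
  by rewrite mulrA ler_pdivrMr //; nra.
have e1 : r%:R / s <= 1 by rewrite ler_pdivrMr //; nra.
have step (a b : R) (i : nat) : (i < r)%N -> 0 <= b ->
    p * (1 - i%:R * (r%:R / s)) <= a -> a * (1 - r%:R / s) <= b ->
    p * (1 - i.+1%:R * (r%:R / s)) <= b.
  move=> ir b0 pa ab; apply: le_trans ab.
  have e0 : 0 <= r%:R / s by rewrite divr_ge0 // ltW.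
  apply: (@le_trans _ _ (p * (1 - i%:R * (r%:R / s)) * (1 - r%:R / s))).
    rewrite -mulrA ler_wpM2l // -natr1.
    have i0 : 0 <= i%:R :> R by [].
    have := mulr_ge0 i0 (mulr_ge0 e0 e0).
    move: (r%:R / s) (i%:R : R) => e j; nra.
  by rewrite ler_wpM2r // subr_ge0.
have [m mP] : exists m, forall i, (i < r)%N -> p / 2 <= poisson_pmf s (m + i).
  have [ks|sk] := leP k%:R s.
    exists k => i ir; apply: le_trans (bern _ (ltnW ir)) _.
    elim: i ir => [|i IH] ir; first by rewrite mul0r subr0 mulr1 addn0.
    apply: (step _ _ _ (ltnW ir) (poisson_pmf_ge0 _ _) (IH (ltnW ir))).
    have N0 : 0 < (k + i).+1%:R :> R by rewrite ltr0n.
    rewrite addnS -(ler_pM2r N0) poisson_pmfS // -mulrA.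
    rewrite ler_wpM2l ?poisson_pmf_ge0 //.
    have Nsr : (k + i).+1%:R <= s + r%:R.
      by rewrite -addnS natrD lerD // ler_nat ltnW.
    apply: (@le_trans _ _ ((1 - r%:R / s) * (s + r%:R))).
      by rewrite ler_wpM2l // subr_ge0.
    have -> : (1 - r%:R / s) * (s + r%:R) = s - r%:R ^+ 2 / s.
      by field; rewrite gt_eqF.
    by rewrite lerBlDr lerDl divr_ge0 ?exprn_ge0 // ltW.
  (* Ensures that the subtractions [k - i] below are not truncated at 0. *)
  have rk : (r < k)%N by rewrite -(ltr_nat R); apply: le_lt_trans sk; nra.
  have down i : (i < r)%N -> p / 2 <= poisson_pmf s (k - i).
    move=> ir; apply: le_trans (bern _ (ltnW ir)) _.
    elim: i ir => [|i IH] ir; first by rewrite mul0r subr0 mulr1 subn0.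
    apply: (step _ _ _ (ltnW ir) (poisson_pmf_ge0 _ _) (IH (ltnW ir))).
    have kiE : (k - i = (k - i.+1).+1)%N by lia.
    rewrite -(ler_pM2r s0) -poisson_pmfS // -kiE -mulrA.
    rewrite ler_wpM2l ?poisson_pmf_ge0 // mulrBl mul1r divfK ?gt_eqF //.
    by rewrite natrB ?lerB // ?ler_nat; [exact: ltW|lia|lia].
  exists (k - r.-1)%N => i ir.
  have -> : (k - r.-1 + i = k - (r.-1 - i))%N by lia.
  by apply: down; lia.
have := sum_poisson_pmf_le1 m r s0.
have : \sum_(i < r) (p / 2) <= \sum_(i < r) poisson_pmf s (m + i).
  by apply: ler_sum => i _; exact: mP.
rewrite sumr_const card_ord -mulr_natr ler_pdivlMr ?ltr0n // -/p; lra.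
Qed.

(** * Point processes *)

(** Half-open on the same side as [cut]; consecutive intervals also tile without gaps. *)
Definition itvoc (R : realType) (s t : R) : set R := [set x | s < x <= t].

Lemma finite_itvoc (R : realType) (X : set R) (s t : R) :
  locally_finite_set X -> finite_set (X `&` itvoc s t).
Proof.
move=> lX.
apply: sub_finite_set (finite_itv_points s t lX) => x
  [Xx /andP[sx xt]].
by split=> //=; rewrite (ltW sx).
Qed.

(** Meant for half-open intervals and cuts, which are both differences of open sets. *)
Lemma borelD (T : topologicalType) (A B : set T) :
  open A -> open B -> borel (A `\` B).
Proof.
move=> oA oB.
have -> : A `\` B = setT `\` \bigcup_i bigcup2 (setT `\` A) B i.
  by rewrite bigcup2E !setTD setCU setCK setDE.
apply: sigma_algebraCD; apply: sigma_algebra_bigcup => -[|[|i]] /=.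
- by apply: sigma_algebraCD; exact: sub_gen_smallest.
- exact: sub_gen_smallest.
- exact: sigma_algebra0.
Qed.

Lemma borel_itvoc (R : realType) (s t : R) : borel (itvoc s t).
Proof.
have -> : itvoc s t = [set x | s < x] `\` [set x | t < x].
  apply/seteqP; split=> x /=; first by move=> /andP[-> xt]; split=> //; lra.
  by rewrite /itvoc/= => -[-> /negP]; rewrite -leNgt.
exact: (@borelD R _ _ (open_gt (y := s)) (open_gt (y := t))).
Qed.

Lemma borel_cut (R : realType) (t : R) : borel (cut t).
Proof.
have -> : cut t = [set p | t < p.2] `\` [set p | t < p.1].
  apply/seteqP; split=> p /=; first by move=> /andP[pt ->]; split=> //; lra.
  by move=> [tp /negP]; rewrite /cut/= -leNgt tp andbT.
have os : open [set p : R * R | t < p.2].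
  by apply: (@open_comp _ _ snd) (@open_gt R t) => p _; exact: cvg_snd.
have of1 : open [set p : R * R | t < p.1].
  by apply: (@open_comp _ _ fst) (@open_gt R t) => p _; exact: cvg_fst.
exact: borelD os of1.
Qed.

Lemma config_event_count (T : topologicalType) (A : set T) (n : nat) :
  borel A -> config_event [set X | (X `&` A #= `I_n)%card].
Proof. by move=> bA; apply: sub_gen_smallest; exists A, n. Qed.

Lemma config_eventC (T : topologicalType) (C : set (set T)) :
  config_event C -> config_event (~` C).
Proof. by rewrite -setTD; exact: sigma_algebraCD. Qed.

Lemma poisson_prob_set1 (R : realType) (s : R) (k : nat) : 0 < s ->
  poisson_prob s 0 [set k] = (poisson_pmf s k)%:E.
Proof.
move=> s0; rewrite /poisson_prob s0 esum_set1 // lee_fin.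
exact: poisson_pmf_ge0.
Qed.

Lemma poisson_count_itvoc (R : realType) (d : measure_display)
    (Omega : measurableType d) (P : probability Omega R) (lambda : R)
    (X : Omega -> set R) (s t : R) (k : nat) :
  0 < lambda -> s < t -> homogeneous_poisson_process P lambda X ->
  P [set w | (X w `&` itvoc s t #= `I_k)%card] =
  (poisson_pmf (lambda * (t - s)) k)%:E.
Proof.
move=> l0 st [_ XP _].
have IE : itvoc s t = [set` `]s, t] ].
  by apply/seteqP; split => x /=; rewrite in_itv.
have mI : lebesgue_measure (itvoc s t) = (t - s)%:E.
  by rewrite IE lebesgue_measure_itv /= lte_fin st.
rewrite XP; last 2 first.
- by rewrite IE; exact: measurable_itv.
- by rewrite mI ltry.
by rewrite mI /= poisson_prob_set1 // mulr_gt0 // subr_gt0.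
Qed.

(** The intersection of covers of measure at most [n.+1%:R^-1] is a measurable null cover. *)
Lemma negligible_small (R : realType) (d : measure_display)
    (Omega : measurableType d) (P : probability Omega R) (A : set Omega) :
  (forall e : R, 0 < e -> exists B, [/\ measurable B, A `<=` B & (P B <= e%:E)%E]) ->
  P.-negligible A.
Proof.
move=> small.
have /choice[B BP] : forall n, exists B,
    [/\ measurable B, A `<=` B & (P B <= (n.+1%:R^-1)%:E)%E].
  by move=> n; apply: small; rewrite invr_gt0 ltr0n.
have mB n : measurable (B n) by case: (BP n).
have mcap : measurable (\bigcap_n B n) by exact: bigcapT_measurable.
exists (\bigcap_n B n); split => //; last by move=> x Ax n _; case: (BP n) => _ /(_ _ Ax).
apply/eqP; rewrite eq_le measure_ge0 andbT; apply/lee_addgt0Pr => e e0.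
rewrite add0e; have [n ne] := ltr_add_invr e0; rewrite add0r in ne.
have [_ _ Bn] := BP n.
apply: le_trans (le_trans Bn _); last by rewrite lee_fin ltW.
by apply: (le_measure P); [exact: mem_set|exact: mem_set|move=> x; apply].
Qed.

Lemma grid_cell (R : realType) (m : nat) (y : R) : 0 < y -> y <= m%:R ->
  exists2 i, (i < m)%N & i%:R < y <= i.+1%:R.
Proof.
move=> y0; elim: m => [|m IH] ym; first by lra.
have [/IH[i im iy]|my] := leP y m%:R; first by exists i => //; exact: ltnW.
by exists m => //; rewrite my.
Qed.

(** * Common points and balanced counts of two independent Poisson processes *)

Section TwoProcesses.
Variables (R : realType) (d : measure_display) (Omega : measurableType d).
Variables (P : probability Omega R) (lambda : R) (red blue : Omega -> set R).
Hypothesis lambda_gt0 : 0 < lambda.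
Hypothesis red_poisson : homogeneous_poisson_process P lambda red.
Hypothesis blue_poisson : homogeneous_poisson_process P lambda blue.
Hypothesis red_blue_indep : independent_processes P red blue.

Lemma measurable_count (X : Omega -> set R) (s t : R) (k : nat) :
  point_process X -> measurable [set w | (X w `&` itvoc s t #= `I_k)%card].
Proof.
by move=> [_ mX]; apply: (mX _ (config_event_count k (borel_itvoc s t))).
Qed.

(** This is [1 - expR (- u) <= u] for the mean [u] of the count. *)
Lemma hit_le (X : Omega -> set R) (s t : R) : s < t ->
  homogeneous_poisson_process P lambda X ->
  (P (~` [set w | (X w `&` itvoc s t #= `I_0)%card]) <= (lambda * (t - s))%:E)%E.
Proof.
move=> st XP; rewrite probability_setC; last by apply: measurable_count; case: XP.
rewrite (poisson_count_itvoc _ lambda_gt0 st XP) -EFinB lee_fin.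
rewrite /poisson_pmf mulr_gt0 ?subr_gt0// expr0 fact0 invr1 !mul1r.
by rewrite lerBlDr -lerBlDl expR_ge1Dx.
Qed.

(* Cut the interval into [m] cells: the probability that some cell is hit by both
   processes is at most [m * (lambda * (b - a) / m) ^ 2]. *)
Lemma ae_disjoint_itv (a b : R) : a < b ->
  P.-negligible [set w | exists x, [/\ itvoc a b x, red w x & blue w x]].
Proof.
move=> ab; apply: negligible_small => e e0.
have [m mP] : exists m : nat, (lambda * (b - a)) ^+ 2 / e < m%:R.
  by exists (Num.bound ((lambda * (b - a)) ^+ 2 / e)); apply: archi_boundP;
    rewrite divr_ge0 ?sqr_ge0 // ltW.
have m_gt0 : 0 < m%:R :> R.
  by apply: le_lt_trans mP; rewrite divr_ge0 ?sqr_ge0 // ltW.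
pose g (i : nat) := a + (b - a) * i%:R / m%:R.
have gS i : g i.+1 - g i = (b - a) / m%:R.
  by rewrite /g -natr1; field; rewrite gt_eqF.
have gg i : g i < g i.+1 by rewrite -subr_gt0 gS divr_gt0 // subr_gt0.
pose hit (X : Omega -> set R) i :=
  ~` [set w | (X w `&` itvoc (g i) (g i.+1) #= `I_0)%card].
have mhit X i : homogeneous_poisson_process P lambda X -> measurable (hit X i).
  by move=> XP; apply: measurableC; apply: measurable_count; case: XP.
exists (\big[setU/set0]_(i < m) (hit red i `&` hit blue i)); split.
- by apply: bigsetU_measurable => i _; apply: measurableI; exact: mhit.
- move=> w [x [/andP[ax xb] rx bx]].
  (* In this rescaled coordinate the cells are the intervals []i, i.+1]]. *)
  have y0 : 0 < (x - a) * m%:R / (b - a).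
    by rewrite divr_gt0 ?mulr_gt0 // subr_gt0.
  have ym : (x - a) * m%:R / (b - a) <= m%:R.
    by rewrite ler_pdivrMr ?subr_gt0 // mulrC ler_pM2l // lerB.
  have [i im /andP[iy yi]] := grid_cell y0 ym.
  rewrite -(bigcup_mkord _ (fun i => hit red i `&` hit blue i)); exists i => //=.
  have xI : itvoc (g i) (g i.+1) x.
    rewrite /itvoc/= /g -ltrBrDl -lerBlDl ltr_pdivrMr // ler_pdivlMr //.
    by rewrite ![(b - a) * _]mulrC -ltr_pdivlMr ?subr_gt0 // iy -ler_pdivrMr ?subr_gt0.
  by split; rewrite /hit/= II0 card_eq0 => /eqP E;
    have : (set0 : set R) x by rewrite -E.
apply: (@le_trans _ _ (\sum_(i < m) ((lambda * ((b - a) / m%:R)) ^+ 2)%:E)%E).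
  apply: (@le_trans _ _ (\sum_(i < m) P (hit red i `&` hit blue i))%E).
    apply: (Boole_inequality P (A := fun i => hit red i `&` hit blue i)).
    by move=> i _; apply: measurableI; exact: mhit.
  apply: lee_sum => i _.
  have miss := config_event_count 0 (borel_itvoc (g i) (g i.+1)).
  have := red_blue_indep (config_eventC miss) (config_eventC miss).
  rewrite !preimage_setC => ->; rewrite expr2 EFinM -(gS i).
  by apply: lee_pmul => //; exact: hit_le.
rewrite sumEFin lee_fin sumr_const card_ord -[leLHS]mulr_natr.
have -> : (lambda * ((b - a) / m%:R)) ^+ 2 * m%:R = (lambda * (b - a)) ^+ 2 / m%:R.
  by field; rewrite gt_eqF.
by rewrite ler_pdivrMr // [e * _]mulrC -ler_pdivrMr // ltW.
Qed.

Lemma ae_disjoint : {ae P, forall w x, red w x -> ~ blue w x}.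
Proof.
pose N n := [set w | exists x,
  [/\ itvoc (- n.+1%:R : R) n.+1%:R x, red w x & blue w x]].
have [B [mB PB NB]] : P.-negligible (\bigcup_n N n).
  by apply: negligible_bigcup => n; apply: ae_disjoint_itv;
    rewrite (@lt_trans _ _ 0) ?oppr_lt0 ?ltr0n.
exists B; split => // w; rewrite /=.
move=> /existsNP[x /not_implyP[rx /contrapT bx]]; apply: NB.
have xb := archi_boundP (normr_ge0 x).
exists (Num.bound `|x|) => //; exists x; split => //.
have {}xb : `|x| < (Num.bound `|x|).+1%:R.
  by apply: lt_le_trans xb _; rewrite ler_nat.
by move: xb; rewrite ltr_norml /itvoc/= => /andP[-> /ltW].
Qed.

(** Given the red count, the blue count has at most [2 * n + 1] admissible values, each of
    probability at most [2 / r] by independence and the bound on Poisson atoms. The probabilities of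
    the red counts sum to at most 1. *)
Lemma balanced_count_small (s t : R) (n r : nat) : s < t -> (0 < r)%N ->
  2 * r%:R ^+ 2 <= lambda * (t - s) ->
  exists B, [/\ measurable B,
    [set w | exists a b, [/\ (red w `&` itvoc s t #= `I_a)%card,
      (blue w `&` itvoc s t #= `I_b)%card, (a <= b + n)%N & (b <= a + n)%N]]
      `<=` B &
    (P B <= ((2 / r%:R) *+ (n + n).+1)%:E)%E].
Proof.
move=> st r0 rst.
pose cnt (X : Omega -> set R) k := [set w | (X w `&` itvoc s t #= `I_k)%card].
have mred k : measurable (cnt red k) by apply: measurable_count; case: red_poisson.
have mblue k : measurable (cnt blue k) by apply: measurable_count; case: blue_poisson.
(* The index [j] runs from 0 to [2 * n]. Truncated subtraction only repeats the value 0, which does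
   not harm an upper bound. *)
pose D k j := cnt red k `&` cnt blue (k + j - n)%N.
have mD k j : measurable (D k j) by exact: measurableI.
pose B k := \big[setU/set0]_(j < (n + n).+1) D k j.
have mB k : measurable (B k) by apply: bigsetU_measurable => j _.
have mUB : measurable (\bigcup_k B k) by exact: bigcupT_measurable.
exists (\bigcup_k B k); split=> //.
  move=> w [a [b [ra bb ab ba]]]; exists a => //.
  rewrite /B -bigcup_mkord; exists (b + n - a)%N => /=; first by lia.
  by split=> //; rewrite /cnt/= (_ : (a + _ - n = b)%N)//; lia.
have PD k j : (P (D k j) <= P (cnt red k) * (2 / r%:R)%:E)%E.
  have := red_blue_indep (config_event_count k (borel_itvoc s t))
    (config_event_count (k + j - n) (borel_itvoc s t)).
  move=> ->; rewrite lee_wpmul2l // (poisson_count_itvoc _ lambda_gt0 st blue_poisson).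
  by rewrite lee_fin poisson_pmf_le.
have PB k : (P (B k) <= ((2 / r%:R) *+ (n + n).+1)%:E * P (cnt red k))%E.
  apply: (le_trans (Boole_inequality P (A := D k) _)) => //.
  apply: (@le_trans _ _ (\sum_(j < (n + n).+1) P (cnt red k) * (2 / r%:R)%:E)%E).
    by apply: lee_sum => j _; exact: PD.
  rewrite -ge0_sume_distrr; last by move=> j _; rewrite lee_fin divr_ge0.
  by rewrite sumEFin sumr_const card_ord muleC.
apply: le_trans (generalized_Boole_inequality P mB mUB) _.
apply: (@le_trans _ _
    (\sum_(0 <= k <oo) ((2 / r%:R) *+ (n + n).+1)%:E * P (cnt red k))%E).
  by apply: lee_nneseries => // k _; exact: PB.
rewrite nneseriesZl; last by move=> *.
rewrite -[leRHS]mule1 lee_wpmul2l //.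
have tcnt : trivIset setT (cnt red).
  move=> i j _ _ [w [/= ri rj]]; apply/card_eq_II.
  by rewrite (card_eql (card_esym ri)).
have <- : P (\bigcup_k cnt red k) = (\sum_(0 <= k <oo) P (cnt red k))%E.
  by rewrite measure_bigcup //; apply: eq_eseriesl => k; rewrite in_setT.
by apply: probability_le1; exact: bigcupT_measurable.
Qed.

End TwoProcesses.

(* If the overlaps are at most [p / 2m], each new event adds at least [p / 2]
   to the measure of the union of the first [m] of them. *)
Lemma almost_disjoint_null (R : realType) (d : measure_display)
    (Omega : measurableType d) (P : probability Omega R) (E : nat -> set Omega)
    (p : R) :
  (forall i, measurable (E i)) -> (forall i, P (E i) = p%:E) ->
  (forall e : R, 0 < e -> exists l, forall i j, (i < j)%N ->
    (P (E (i * l)%N `&` E (j * l)%N) <= e%:E)%E) ->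
  p = 0.
Proof.
move=> mE PE small; apply/eqP; rewrite eq_le andbC.
have -> /= : 0 <= p by rewrite -lee_fin -(PE 0).
rewrite leNgt; apply/negP => p0.
(* A union of [m.+1] events, each adding [p / 2], would have measure above 1. *)
have [m mp] : exists m : nat, 2 / p < m.+1%:R.
  exists (Num.bound (2 / p)); apply: (@lt_le_trans _ _ (Num.bound (2 / p))%:R).
    by apply: archi_boundP; rewrite divr_ge0 // ltW.
  by rewrite ler_nat.
have m0 : 0 < m.+1%:R :> R by rewrite ltr0n.
have [l lP] := small (p / (2 * m.+1%:R)) (divr_gt0 p0 (mulr_gt0 (ltr0n _ 2) m0)).
pose F k := \big[setU/set0]_(i < k) E (i * l)%N.
have mF k : measurable (F k) by apply: bigsetU_measurable => i _.
have Ffin A : measurable A -> P A = (fine (P A))%:E.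
  by move=> mA; rewrite fineK // fin_num_measure.
have overlap k : (k <= m.+1)%N -> (P (F k `&` E (k * l)%N) <= (p / 2)%:E)%E.
  move=> km; rewrite /F big_distrl/=.
  apply: le_trans (Boole_inequality P (A := fun i => E (i * l)%N `&` E (k * l)%N) _) _.
    by move=> i _; exact: measurableI.
  apply: (@le_trans _ _ (\sum_(i < k) (p / (2 * m.+1%:R))%:E)%E).
    by apply: lee_sum => i _; apply: lP.
  rewrite sumEFin lee_fin sumr_const card_ord -[leLHS]mulr_natr.
  have kM : k%:R <= m.+1%:R :> R by rewrite ler_nat.
  by rewrite mulrAC ler_pdivrMr ?mulr_gt0 //; nra.
have grow k : (k <= m.+1)%N -> ((k%:R * (p / 2))%:E <= P (F k))%E.
  elim: k => [|k IH] km; first by rewrite mul0r.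
  have PU : P (F k `|` E (k * l)%N)
      = (P (F k) + P (E (k * l)%N) - P (F k `&` E (k * l)%N))%E.
    by apply: measureUfinr => //; rewrite ltey_eq fin_num_measure.
  rewrite /F big_ord_recr/= -/(F k) PU.
  have := overlap k (ltnW km); have := IH (ltnW km); rewrite PE.
  rewrite (Ffin (F k)) // (Ffin (F k `&` _)); last exact: measurableI.
  move: (fine (P (F k))) (fine (P (F k `&` _))) => u v; rewrite !lee_fin => ku vp.
  by rewrite -natr1; lra.
have := le_trans (grow m.+1 (leqnn _)) (probability_le1 P (mF _)).
rewrite lee_fin; move: mp; rewrite ltr_pdivrMr //; lra.
Qed.

(** * Edges crossing a point *)

Lemma cut_count_stationary (R : realType) (d : measure_display)
    (Omega : measurableType d) (P : probability Omega R)
    (M : Omega -> set (R * R)) (n : nat) (t : R) :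
  translation_invariant P M ->
  P [set w | (M w `&` cut t #= `I_n)%card] =
  P [set w | (M w `&` cut 0 #= `I_n)%card].
Proof.
move=> /(_ (- t) _ (config_event_count n (borel_cut 0))) <-.
congr (P _); apply/seteqP.
pose f (p : R * R) := (p.1 + - t, p.2 + - t).
have finj : injective f.
  by move=> [a b] [a' b'] [] /addIr -> /addIr ->.
have fE X : shift_pairs (- t) X `&` cut 0 = f @` (X `&` cut t).
  apply/seteqP; split=> [_ [[p Xp <-]] | _ [p [Xp pt] <-]].
    rewrite /cut/= subr_le0 subr_gt0 => pt; exists p => //.
  by split; [exists p | rewrite /cut/= subr_le0 subr_gt0].
have cE X : (shift_pairs (- t) X `&` cut 0 #= `I_n)%card
    = (X `&` cut t #= `I_n)%card.
  rewrite fE; apply: card_eql; apply: inj_card_eq.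
  by move=> p q _ _; exact: finj.
by split=> w /=; rewrite cE.
Qed.

Section StableMatching.
Variables (R : realType) (d : measure_display) (Omega : measurableType d).
Variables (P : probability Omega R) (lambda : R) (red blue : Omega -> set R).
Variable (M : Omega -> set (R * R)).
Hypothesis lambda_gt0 : 0 < lambda.
Hypothesis red_poisson : homogeneous_poisson_process P lambda red.
Hypothesis blue_poisson : homogeneous_poisson_process P lambda blue.
Hypothesis red_blue_indep : independent_processes P red blue.
Hypothesis M_scheme : two_color_multimatching_scheme P 2 2 red blue M.

Lemma measurable_cut_count (t : R) (n : nat) :
  measurable [set w | (M w `&` cut t #= `I_n)%card].
Proof.
by case: M_scheme => -[_ mM] _ _; apply: (mM _ (config_event_count n (borel_cut t))).
Qed.

(** Outside a null set, [card_red_le] applied in both colour orders shows that the red and blue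
    counts between [s] and [t] differ by at most [n]. *)
Lemma cut_counts_small (s t : R) (n r : nat) : s < t -> (0 < r)%N ->
  2 * r%:R ^+ 2 <= lambda * (t - s) ->
  (P ([set w | (M w `&` cut s #= `I_n)%card] `&`
      [set w | (M w `&` cut t #= `I_n)%card]) <=
   ((2 / r%:R) *+ (n + n).+1)%:E)%E.
Proof.
move=> st r0 rst.
have [B [mB BP PB]] := balanced_count_small lambda_gt0 red_poisson blue_poisson
  red_blue_indep n st r0 rst.
have [_ _ Mm] := M_scheme.
have dis := ae_disjoint lambda_gt0 red_poisson blue_poisson red_blue_indep.
have [N [mN PN NP]] : P.-negligible (~` [set w |
    two_color_multimatching 2 2 (red w) (blue w) (M w) /\
    forall x, red w x -> ~ blue w x]).
  have both : \forall w \ae P, two_color_multimatching 2 2 (red w) (blue w) (M w) /\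
      forall x, red w x -> ~ blue w x.
    by apply: filterS2 Mm dis => w; split.
  exact: both.
have mE := measurable_cut_count.
have mNB : measurable (B `|` N) by exact: measurableU.
apply: (@le_trans _ _ (P (B `|` N))).
  apply: (le_measure P); [exact/mem_set/measurableI|exact: mem_set|].
  move=> w [Es Et]; have [Nw|Nw] := pselect (N w); [by right|left].
  have [Mw dw] : two_color_multimatching 2 2 (red w) (blue w) (M w) /\
      forall x, red w x -> ~ blue w x.
    by apply: contrapT => h; apply: Nw; exact: NP.
  case: red_poisson => -[/(_ w) lfr _] _ _; case: blue_poisson => -[/(_ w) lfb _] _ _.
  have /finite_setP[a ra] := finite_itvoc s t lfr.
  have /finite_setP[b bb] := finite_itvoc s t lfb.
  apply: BP; exists a, b; split => //.
    exact: card_red_le dw Mw Es Et ra bb.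
  apply: card_red_le (two_color_multimatchingC Mw) Es Et bb ra => x bx rx.
  exact: dw rx bx.
rewrite -[leRHS]adde0 -PN; apply: le_trans (leeD2r _ PB).
rewrite measureUfinr ?lte_fin //; last by rewrite ltey_eq fin_num_measure.
by rewrite leeBlDr ?fin_num_measure ?leeDl //; exact: measurableI.
Qed.

(** By stationarity the events at all integers have the same probability, and those at distant
    integers overlap little. *)
Lemma cut_count_null (t : R) (n : nat) :
  P [set w | (M w `&` cut t #= `I_n)%card] = 0%E.
Proof.
have stat := cut_count_stationary n _ (let: And3 _ ti _ := M_scheme in ti).
rewrite stat; set p := P _.
have pfin : p \is a fin_num by apply: fin_num_measure; exact: measurable_cut_count.
rewrite -(fineK pfin); congr (_%:E).
apply: (almost_disjoint_null
  (E := fun i => [set w | (M w `&` cut i%:R #= `I_n)%card])).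
- by move=> i; exact: measurable_cut_count.
- by move=> i; rewrite fineK //; exact: stat.
move=> e e0.
(* [r] brings the bound on overlaps below [e]; the spacing [l] then makes the Poisson mean at least
   [2 * r ^ 2]. *)
pose r := (Num.bound (2 * (n + n).+1%:R / e)).+1.
have re : 2 * (n + n).+1%:R / e < r%:R.
  apply: (@lt_le_trans _ _ (r.-1)%:R); last by rewrite ler_nat.
  by apply: archi_boundP; rewrite divr_ge0 ?mulr_ge0 // ltW.
pose l := (Num.bound (2 * r%:R ^+ 2 / lambda)).+1.
have ll : 2 * r%:R ^+ 2 / lambda < l%:R.
  apply: (@lt_le_trans _ _ (l.-1)%:R); last by rewrite ler_nat.
  by apply: archi_boundP; rewrite divr_ge0 ?mulr_ge0 ?exprn_ge0 // ltW.
exists l => i j ij.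
have lij : l%:R <= (j * l)%N%:R - (i * l)%N%:R :> R.
  by rewrite lerBrDl -natrD ler_nat -mulSnr leq_mul2r ij orbT.
have l0 : 0 < l%:R :> R by rewrite ltr0n.
have r0 : 0 < r%:R :> R by rewrite ltr0n.
apply: le_trans (cut_counts_small (r := r) _ _ _ _) _ => //.
- by rewrite -subr_gt0; exact: lt_le_trans lij.
- apply: (@le_trans _ _ (lambda * l%:R)); last by rewrite ler_pM2l.
  by rewrite [lambda * _]mulrC -ler_pdivrMr // ltW.
rewrite lee_fin -[leLHS]mulr_natr mulrAC ler_pdivrMr // [e * _]mulrC.
by rewrite -ler_pdivrMr // ltW.
Qed.

Lemma ae_cut_infinite :
  {ae P, forall w (q : rat), infinite_set (M w `&` cut (ratr q : R))}.
Proof.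
(* Rationals are replaced by their natural codes, so that the almost sure statements combine over a
   countable index; a number coding no rational gives a vacuous statement. *)
have cn (k : nat) : \forall w \ae P, forall (n : nat) (q : rat),
    choice.unpickle k = Some q ->
    ~ (M w `&` cut (ratr q : R) #= `I_n)%card.
  apply: ae_foralln => n; case: (choice.unpickle k) => [q|]; last exact: aeW.
  exists [set w | (M w `&` cut (ratr q : R) #= `I_n)%card]; split.
  - exact: measurable_cut_count.
  - exact: cut_count_null.
  by move=> w /= nw; apply: contrapT => h; apply: nw => q' [<-].
apply: filterS (ae_foralln cn) => w cw q /finite_setP[n].
by apply: (cw (choice.pickle q) n q); rewrite choice.pickleK.
Qed.

End StableMatching.

Theorem theorem1 (R : realType) (d : measure_display)
  (Omega : measurableType d) (P : probability Omega R)
  (lambda : R) (lambda_gt0 : 0 < lambda)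
  (red blue : Omega -> set R)
  (red_poisson : homogeneous_poisson_process P lambda red)
  (blue_poisson : homogeneous_poisson_process P lambda blue)
  (red_blue_indep : independent_processes P red blue)
  (M : Omega -> set (R * R))
  (M_stable : stable_multimatching_scheme P 2 2 red blue M) :
  {ae P, forall w, no_infinite_component (red w) (blue w) (M w)}.
Proof.
have [M_scheme Ms] := M_stable; have [_ _ Mm] := M_scheme.
have dis := ae_disjoint lambda_gt0 red_poisson blue_poisson red_blue_indep.
have ci := ae_cut_infinite lambda_gt0 red_poisson blue_poisson red_blue_indep
  M_scheme.
apply: filterS2 (filterI dis Mm) (filterI Ms ci) => w [dw Mw] [Sw cw].
apply: no_infinite_component_of_cuts => //.
  by case: red_poisson => -[].
by case: blue_poisson => -[].
Qed.
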